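(* Let $\mathrm{cl}$ be a closure operator on a finite set $V$ which is a matroid. Then $\mathrm{cl}$ is solvable over some finite alphabet $A$ with $|A|\ge 2$ if and only if $\mathrm{cl}$ is a secret-sharing matroid.
   Context: A closure operator on $V$ is a map $\mathrm{cl}:2^V\to 2^V$ that is extensive ($X\subseteq \mathrm{cl}(X)$), isotone ($X\subseteq Y\Rightarrow \mathrm{cl}(X)\subseteq \mathrm{cl}(Y)$) and idempotent. It is a matroid if it satisfies the exchange property: if $X\subseteq V$, $v\in V$ and $u\in \mathrm{cl}(X\cup\{v\})\setminus \mathrm{cl}(X)$, then $v\in \mathrm{cl}(X\cup\{u\})$. Its rank function is $\mathrm{rk}(X)=\min\{|b|: \mathrm{cl}(b)=\mathrm{cl}(X)\}$. The rank of $\mathrm{cl}$ is $r=\min\{|b|: \mathrm{cl}(b)=V\}$ (so $r=\mathrm{rk}(V)$ for a matroid). For a finite set $A$ with $|A|\ge2$ and a family $f=(f_v)_{v\in V}$ of partitions of $A^r$, $f_X$ ($X\subseteq V$) denotes the common refinement of the $f_v$, $v\in X$ (parts are the nonempty intersections of parts; $f_\emptyset$ has one part). A coding function for $\mathrm{cl}$ over $A$ is a family $f$ of partitions of $A^r$, each into at most $|A|$ parts, such that $f_X=f_{\mathrm{cl}(X)}$ for all $X\subseteq V$. $\mathrm{cl}$ is solvable over $A$ if it has a coding function $f$ such that $f_V$ is the partition of $A^r$ into singletons. A matroid $\mathrm{cl}$ of rank $r$ is a secret-sharing matroid if it has a representation by partitions: there exist a finite set $A$ with $|A|\ge 2$ and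 a family $(f_v)_{v\in V}$ of partitions of $A^r$ such that for every $X\subseteq V$ the partition $f_X$ has exactly $|A|^{\mathrm{rk}(X)}$ parts, all of the same cardinality. *)

(* Defs.v *)
From mathcomp Require Import all_boot.

Set Implicit Arguments.
Unset Strict Implicit.
Unset Printing Implicit Defensive.

Section ClosureOperators.
Variables (V : finType) (cl : {set V} -> {set V}).

Definition is_closure : Prop :=
  [/\ forall X : {set V}, X \subset cl X,
      forall X Y : {set V}, X \subset Y -> cl X \subset cl Y
    & forall X : {set V}, cl (cl X) = cl X].

Definition exchange_property : Prop :=
  forall (X : {set V}) (v u : V),
    u \in cl (v |: X) :\: cl X -> v \in cl (u |: X).

Definition is_matroid : Prop := is_closure /\ exchange_property.

Definition rk (X : {set V}) : nat :=
  #|[arg min_(b < X | cl b == cl X) #|b|]|.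

(* The default value [set: V] satisfies the constraint as soon as cl is
   extensive. *)
Definition cl_rank : nat :=
  #|[arg min_(b < [set: V] | cl b == [set: V]) #|b|]|.

End ClosureOperators.

Section CommonRefinement.
Variables (V T : finType) (f : V -> {set {set T}}).

Definition partition_family : Prop := forall v, partition (f v) [set: T].

(* The values of p outside X are irrelevant. For X = set0 the intersection is
   [set: T], so that for nonempty T the refinement is the one-part partition. *)
Definition refinement (X : {set V}) : {set {set T}} :=
  [set B : {set T} | (B != set0) &&
     [exists p : {ffun V -> {set T}},
        [forall (v | v \in X), p v \in f v]
        && (B == \bigcap_(v in X) p v)]].

End CommonRefinement.

Section Solvability.
Variables (V : finType) (cl : {set V} -> {set V}).

Definition word (A : finType) : finType := {ffun 'I_(cl_rank cl) -> A}.

Definition coding_function (A : finType) (f : V -> {set {set word A}}) : Prop :=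
  [/\ partition_family f,
      forall v, #|f v| <= #|A|
    & forall X : {set V}, refinement f X = refinement f (cl X)].

Definition singletons (T : finType) : {set {set T}} := [set [set x] | x : T].

Definition solvable_over (A : finType) : Prop :=
  exists f : V -> {set {set word A}},
    coding_function f /\ refinement f [set: V] = singletons (word A).

Definition represented_by (A : finType) (f : V -> {set {set word A}}) : Prop :=
  partition_family f /\
  forall X : {set V},
    #|refinement f X| = #|A| ^ rk cl X /\
    {in refinement f X &, forall B C : {set word A}, #|B| = #|C|}.

Definition secret_sharing : Prop :=
  exists A : finType, 1 < #|A| /\
    exists f : V -> {set {set word A}}, represented_by f.

End Solvability.

(* Main.v *)
Require Import Defs.
From mathcomp Require Import all_boot.

Set Implicit Arguments.
Unset Strict Implicit.
Unset Printing Implicit Defensive.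

(** If cl is solved by f, let b be a minimal spanning set of X; by Steinitz
    exchange b extends by r - rk X points c to a spanning set of V. Then f_X
    has at most |A|^|b| parts, and each part, being cut into singletons by f_c,
    has at most |A|^|c| elements. As A^r has |A|^(|b|+|c|) elements, both
    bounds are attained. Conversely, f_(cl X) refines f_X, and two comparable
    partitions with equally many parts coincide. *)

(** * Maps that factor through another map on a finite set *)

Section Factor.
Variables (T U W : finType) (g : T -> U) (h : T -> W) (S : {set T}).
Hypothesis hg : {in S &, forall s t, h s = h t -> g s = g t}.

(* The set of pairs (h t, g t) is the graph of the map through which g
   factors. *)
Let graph := [set (h t, g t) | t in S].

Let card_graph : #|graph| = #|h @: S|.
Proof.
have -> : h @: S = fst @: graph by rewrite -imset_comp; apply: eq_imset.
rewrite card_in_imset // => _ _ /imsetP[s sS ->] /imsetP[t tS ->] /= hst.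
by rewrite hst (hg sS tS hst).
Qed.

Let imset_graph : g @: S = snd @: graph.
Proof. by rewrite -imset_comp; apply: eq_imset. Qed.

Lemma card_imset_factor : #|g @: S| <= #|h @: S|.
Proof. by rewrite imset_graph -card_graph leq_imset_card. Qed.

(** The second projection maps the graph onto the image of [g]; when both have the same size it is
    injective, so [g] determines [h] as well. *)
Lemma imset_factor_inj : #|g @: S| = #|h @: S| ->
  {in S &, forall s t, g s = g t -> h s = h t}.
Proof.
rewrite imset_graph -card_graph => /eqP/imset_injP inj_snd s t sS tS gst.
suff [] : (h s, g s) = (h t, g t) by [].
by apply: inj_snd => //; apply: imset_f.
Qed.

End Factor.

(** * Steinitz exchange, rank and bases *)

Section Matroid.
Variables (V : finType) (cl : {set V} -> {set V}).
Hypothesis cl_matroid : is_matroid cl.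

Lemma sub_cl (X : {set V}) : X \subset cl X.
Proof. by case: cl_matroid => -[]. Qed.

Lemma clS (X Y : {set V}) : X \subset Y -> cl X \subset cl Y.
Proof. by case: cl_matroid => -[_ + _ _]; apply. Qed.

Lemma clK (X : {set V}) : cl (cl X) = cl X.
Proof. by case: cl_matroid => -[]. Qed.

Lemma cl_sub_cl (X Y : {set V}) : X \subset cl Y -> cl X \subset cl Y.
Proof. by move=> /clS; rewrite clK. Qed.

Lemma cl_setT : cl [set: V] = [set: V].
Proof. by apply/eqP; rewrite -subTset sub_cl. Qed.

(** Induction on the size of [b]: a set [c'] completing [b :\ x] can give up one element in return
    for [x]. *)
Lemma steinitz (b e : {set V}) :
    (forall x, x \in b -> x \notin cl (b :\ x)) -> cl e = [set: V] ->
  exists c : {set V}, #|c| + #|b| <= #|e| /\ cl (b :|: c) = [set: V].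
Proof.
move=> + eV; have [n le_bn] := ubnP #|b|; elim: n => // n IH in b le_bn *.
have [-> _|[x xb] ind_b] := set_0Vmem b.
  by exists e; rewrite cards0 addn0 set0U.
have bD := setD1K xb; have cardb := cardsD1 x b.
have [|y|c' [card_c' spn]] := IH (b :\ x).
- by move: le_bn; rewrite cardb xb.
- rewrite !inE => /andP[yx yb]; apply: contra (ind_b y yb).
  by apply: subsetP; apply: clS; apply: setSD; apply: subD1set.
have ex_d : x \in cl (b :\ x :|: c') by rewrite spn.
(* A minimal part [d] of [c'] that generates [x] over [b :\ x] is nonempty by independence of [b].
   For [y] in [d], minimality and exchange put [y] in the closure of [b] and [d :\ y], so [y] may
   leave [c']. *)
have [d /minsetP[xd min_d] sdc] :=
  @minset_exists _ (fun d => x \in cl (b :\ x :|: d)) _ ex_d.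
have [d0|[y yd]] := set_0Vmem d.
  by move: (ind_b x xb) xd; rewrite d0 setU0 => /negP.
have dy : x \notin cl (b :\ x :|: d :\ y).
  apply/negP => /min_d /(_ (subD1set _ _)) /setP /(_ y).
  by rewrite !inE eqxx yd.
have y_in : y \in cl (x |: (b :\ x :|: d :\ y)).
  case: cl_matroid => _; apply; rewrite inE dy /=.
  by rewrite setUCA setD1K.
have yc := subsetP sdc _ yd; exists (c' :\ y); split.
  move: card_c'; rewrite (cardsD1 y c') yc cardb xb /=.
  by rewrite addnCA addnA.
apply/eqP; rewrite -subTset -spn; apply: cl_sub_cl.
apply/subsetP => z; rewrite inE => /orP[].
  by move=> /(subsetP (subD1set _ _)) zb; apply: (subsetP (sub_cl _)); rewrite inE zb.
have [-> _|zy zc] := eqVneq z y.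
  apply: subsetP y_in; apply: clS.
  by rewrite setUA bD setUS // setSD.
by apply: (subsetP (sub_cl _)); rewrite !inE zy zc orbT.
Qed.

Lemma rk_le (X Y : {set V}) : cl Y = cl X -> rk cl X <= #|Y|.
Proof.
by move=> /eqP clYX; rewrite /rk; case: arg_minnP => // b _; apply.
Qed.

Lemma rk_basis (X : {set V}) : exists2 b, cl b = cl X & rk cl X = #|b|.
Proof. by rewrite /rk; case: arg_minnP => // b /eqP; exists b. Qed.

Lemma rk_cl (X : {set V}) : rk cl (cl X) = rk cl X.
Proof.
apply/eqP; rewrite eqn_leq; apply/andP; split.
  by have [b bX ->] := rk_basis X; rewrite rk_le // clK.
by have [b + ->] := rk_basis (cl X); rewrite clK => bX; rewrite rk_le.
Qed.

Lemma cl_rankE : cl_rank cl = rk cl [set: V].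
Proof. by rewrite /rk cl_setT. Qed.

(** Steinitz against a minimum spanning set [e] bounds the total size by the rank; since [b :|: c]
    spans, the total cannot be smaller. *)
Lemma basis_extension (X : {set V}) : exists b c : {set V},
  [/\ cl b = cl X, #|b| = rk cl X, cl (b :|: c) = [set: V]
    & #|c| + #|b| = cl_rank cl].
Proof.
have [b bX rkX] := rk_basis X; have [e + rkV] := rk_basis [set: V].
rewrite cl_setT => eV.
have [|//|c [le_bc spn]] := @steinitz b e.
  (* A generating set of least size is independent: a redundant [x] could be dropped without
     changing the closure. *)
  move=> x xb; apply/negP => xcl; suff: rk cl X <= #|b :\ x|.
    by rewrite rkX (cardsD1 x b) xb add1n ltnn.
  apply/rk_le/eqP; rewrite -bX eqEsubset clS ?subD1set //= cl_sub_cl //.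
  by rewrite -{1}(setD1K xb) subUset sub1set xcl sub_cl.
exists b, c; split=> //; apply/eqP; rewrite cl_rankE eqn_leq {1}rkV le_bc /=.
rewrite (leq_trans (rk_le (Y := b :|: c) _)) ?cl_setT //.
by rewrite addnC cardsU leq_subr.
Qed.

End Matroid.

(** * Common refinements as images of block maps *)

Section Refinement.
Variables (V T : finType) (f : V -> {set {set T}}).
Hypothesis f_part : partition_family f.

(** The part of the common refinement that contains [t]. Viewed as a map in [t], it turns counting
    parts into counting an image. *)
Definition block (X : {set V}) (t : T) : {set T} :=
  \bigcap_(v in X) pblock (f v) t.

Lemma mem_family_cover v t : t \in cover (f v).
Proof. by rewrite (cover_partition (f_part v)). Qed.

Lemma trivIset_family v : trivIset (f v).
Proof. by have /and3P[] := f_part v. Qed.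

Lemma mem_block (X : {set V}) s t :
  (s \in block X t) = [forall (v | v \in X), pblock (f v) s == pblock (f v) t].
Proof.
apply/bigcapP/forall_inP => st v vX.
  by rewrite eq_sym eq_pblock ?st ?mem_family_cover ?trivIset_family.
rewrite -(eqP (st v vX)) mem_pblock; exact: mem_family_cover.
Qed.

Lemma block_refl (X : {set V}) t : t \in block X t.
Proof. by rewrite mem_block; apply/forall_inP. Qed.

Lemma block_eqP (X : {set V}) s t :
  reflect (forall v, v \in X -> pblock (f v) s = pblock (f v) t)
          (block X s == block X t).
Proof.
apply: (iffP eqP) => [st v vX|st]; last exact: eq_bigr.
apply/eqP; have := block_refl X s; rewrite st mem_block.
by move=> /forall_inP /(_ v vX).
Qed.

Lemma eq_block (X : {set V}) s t :
  (s \in block X t) = (block X s == block X t).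
Proof.
by rewrite mem_block; apply/forall_inP/block_eqP => st v vX; exact/eqP/st.
Qed.

Lemma block_mono (X Y : {set V}) s t :
  X \subset Y -> block Y s = block Y t -> block X s = block X t.
Proof.
move=> /subsetP sXY /eqP/block_eqP st; apply/eqP/block_eqP => v /sXY.
exact: st.
Qed.

(** Any point of a nonempty intersection of parts determines it, each part being the one through
    that point. *)
Lemma refinementE (X : {set V}) : refinement f X = block X @: [set: T].
Proof.
apply/setP => B; rewrite inE; apply/andP/imsetP => [[]|[t _ ->]].
  case/set0Pn => t tB /existsP[p /andP[/forall_inP pf /eqP BE]].
  exists t => //; rewrite BE; apply: eq_bigr => v vX; apply/esym.
  apply: def_pblock; rewrite ?trivIset_family ?pf //.
  by move: tB; rewrite BE => /bigcapP; apply.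
split; first by apply/set0Pn; exists t; exact: block_refl.
apply/existsP; exists [ffun v => pblock (f v) t]; apply/andP; split.
  by apply/forall_inP => v _; rewrite ffunE pblock_mem ?mem_family_cover.
by apply/eqP; apply: eq_bigr => v _; rewrite ffunE.
Qed.

Lemma card_refinement_sum (X : {set V}) :
  #|T| = \sum_(B in refinement f X) #|B|.
Proof.
rewrite -cardsT; apply: card_partition.
suff -> : refinement f X = preim_partition (block X) [set: T].
  exact: preim_partitionP.
rewrite refinementE; apply: eq_imset => t; apply/setP => s.
by rewrite !inE eq_block eq_sym.
Qed.

(** On [S], [g] factors through the tuple of parts indexed by [c]. This serves both to count parts
    and, with [g] the identity, to bound the size of one part. *)
Lemma card_imset_blocks (U : finType) (g : T -> U) (c : {set V}) (S : {set T})
    (n : nat) (f_le : forall v, #|f v| <= n) :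
    {in S &, forall s t, block c s = block c t -> g s = g t} ->
  #|g @: S| <= n ^ #|c|.
Proof.
(* The default [set0] outside [c] places [h t] in a [pfamily] whose size is the product of the
   [#|f v|]. *)
move=> gP; pose h t := [ffun v => if v \in c then pblock (f v) t else set0].
apply: (@leq_trans #|h @: S|).
  apply: card_imset_factor => s t sS tS /ffunP hst; apply: gP => //.
  by apply/eqP/block_eqP => v vc; have := hst v; rewrite !ffunE vc.
apply: (@leq_trans #|pfamily set0 c f|).
  apply/subset_leq_card/subsetP => _ /imsetP[t _ ->].
  apply/pfamilyP; split=> [|v vc]; last first.
    by rewrite ffunE vc pblock_mem ?mem_family_cover.
  by apply/subsetP => v; rewrite inE ffunE; case: ifP; rewrite ?eqxx.
(* Reading the exponent as the number of factors allows induction along the list of factors. *)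
rewrite card_pfamily -(size_image (fun v => #|f v|) (mem c)) /image_mem.
elim: (enum _) => //= v l IHl; rewrite expnS; exact: leq_mul.
Qed.

Lemma refinement_singletonsP :
  refinement f [set: V] = singletons T <-> injective (block [set: V]).
Proof.
split=> [fV s t st|inj].
  have: block [set: V] s \in singletons T.
    by rewrite -fV refinementE imset_f.
  case/imsetP => u _ Bu; have := block_refl [set: V] s.
  by have := block_refl [set: V] t; rewrite -st Bu !inE => /eqP -> /eqP ->.
have blockE t : block [set: V] t = [set t].
  by apply/setP => s; rewrite eq_block inE; exact: inj_eq.
rewrite refinementE; apply/setP => B.
by apply/imsetP/imsetP => -[t _ ->]; exists t; rewrite ?blockE ?inE.
Qed.

(** [block X] factors through [block Y]; equal counts make the factor map injective, so the fibres
    agree. *)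
Lemma refinement_eq_of_card (X Y : {set V}) : X \subset Y ->
  #|refinement f X| = #|refinement f Y| -> refinement f X = refinement f Y.
Proof.
move=> sXY; rewrite !refinementE => cardXY.
have XY : {in [set: T] &, forall s t, block Y s = block Y t -> block X s = block X t}.
  by move=> s t _ _; apply: block_mono.
apply: eq_imset => t; apply/setP => s; rewrite !eq_block; apply/eqP/eqP.
  exact: (imset_factor_inj XY).
exact: block_mono.
Qed.

Lemma refinement_set1 v : refinement f [set v] = f v.
Proof.
rewrite refinementE; apply/setP => B; apply/imsetP/idP => [[t _ ->]|Bf].
  by rewrite /block big_set1 pblock_mem ?mem_family_cover.
have [t tB] : exists t, t \in B.
  by apply/set0Pn; apply: contraTneq Bf => ->; have /and3P[] := f_part v.
by exists t; rewrite // /block big_set1 (def_pblock _ Bf tB) ?trivIset_family.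
Qed.

End Refinement.

(** The sum is at most [#|P| * m], hence at most [k * m]; equality throughout forces both bounds to
    be attained. *)
Lemma card_sum_extremal (U : finType) (P : {set {set U}}) (k m : nat) :
    0 < m -> #|P| <= k -> {in P, forall B : {set U}, #|B| <= m} ->
    \sum_(B in P) #|B| = k * m ->
  #|P| = k /\ {in P, forall B : {set U}, #|B| = m}.
Proof.
move=> m_gt0 le_Pk le_m sumP.
have sumif : \sum_(B in P) #|B| <= \sum_(B in P) m
    ?= iff [forall (B | B \in P), #|B| == m].
  by apply: leqif_sum => B /le_m; exact: leqif_eq.
have Pk : #|P| = k.
  apply/eqP; rewrite eqn_leq le_Pk -(leq_pmul2r m_gt0) -sumP.
  by rewrite -sum_nat_const sumif.
split=> // B PB; have: \sum_(B in P) #|B| == \sum_(B in P) m.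
  by rewrite sumP sum_nat_const Pk.
by rewrite sumif => /forall_inP/(_ B PB)/eqP.
Qed.

(** * Solutions and representations coincide *)

Section Equivalence.
Variables (V : finType) (cl : {set V} -> {set V}) (A : finType).
Hypotheses (cl_matroid : is_matroid cl) (A_gt0 : 0 < #|A|).

Lemma card_word : #|word cl A| = #|A| ^ cl_rank cl.
Proof. by rewrite card_ffun card_ord. Qed.

Lemma solution_represents (f : V -> {set {set word cl A}}) :
    coding_function f -> refinement f [set: V] = singletons (word cl A) ->
  represented_by f.
Proof.
case=> f_part f_le f_cl /(refinement_singletonsP f_part) inj_fV.
split=> // X; have [b [c [bX rkX spn cardV]]] := basis_extension cl_matroid X.
have fXb : refinement f X = refinement f b by rewrite f_cl -bX -f_cl.
have inj_bc : injective (block f (b :|: c)).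
  move=> s t st; apply: inj_fV; apply/eqP; rewrite -eq_block //.
  have /imsetP[u _ uE] : block f [set: V] t \in block f (b :|: c) @: [set: word cl A].
    by rewrite -refinementE // f_cl spn refinementE // imset_f.
  by move: (block_refl f_part [set: V] t); rewrite uE !eq_block ?st.
have [||||PX eqX] := @card_sum_extremal _ (refinement f X)
    (#|A| ^ rk cl X) (#|A| ^ #|c|).
- by rewrite expn_gt0 A_gt0.
- by rewrite fXb refinementE // -rkX; apply: card_imset_blocks.
- move=> B; rewrite fXb refinementE // => /imsetP[t _ ->].
  (* Points of one block of [b] agree on the parts indexed by [b], so those indexed by [c] separate
     them, by [inj_bc]. *)
  rewrite -[block f b t]imset_id.
  apply: (card_imset_blocks f_part (c := c)) => // s u sB uB su; apply: inj_bc.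
  apply/eqP/(block_eqP f_part) => v /setUP[] vX.
    move: sB uB; rewrite !eq_block // => /eqP <- /eqP/esym.
    by move=> /eqP/(block_eqP f_part); apply.
  by move/eqP/(block_eqP f_part): su; apply.
- by rewrite -card_refinement_sum // card_word -cardV -rkX expnD mulnC.
by split=> // B C BX CX; rewrite !eqX.
Qed.

(** Three part counts suffice: a single element has rank at most 1, [X] and [cl X] have equal rank,
    and on all of [V] there are as many parts as words. *)
Lemma representation_solves (f : V -> {set {set word cl A}}) :
    represented_by f ->
  coding_function f /\ refinement f [set: V] = singletons (word cl A).
Proof.
case=> f_part f_rep.
have f_card X : #|refinement f X| = #|A| ^ rk cl X by case: (f_rep X).
split; first split=> // [v|X].
- rewrite -(refinement_set1 f_part v) f_card -{2}(expn1 #|A|) leq_pexp2l //.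
  by rewrite -(cards1 v) rk_le.
- by apply: refinement_eq_of_card; rewrite ?sub_cl // !f_card rk_cl.
apply/(refinement_singletonsP f_part) => s t.
have /imset_injP inj : #|block f [set: V] @: [set: word cl A]| == #|[set: word cl A]|.
  by rewrite -refinementE // f_card -cl_rankE // cardsT card_word.
by apply: inj; rewrite inE.
Qed.

End Equivalence.

Theorem theorem2 (V : finType) (cl : {set V} -> {set V})
    (cl_matroid : is_matroid cl) :
  (exists A : finType, 1 < #|A| /\ solvable_over cl A) <-> secret_sharing cl.
Proof.
split=> -[A [A_gt1 [f]]] => [[f_coding fV]|f_rep]; exists A; split=> //; exists f.
  by apply: solution_represents => //; apply: ltnW.
by apply: representation_solves => //; apply: ltnW.
Qed.
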